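(* Consider the random walk with multiple function barriers $M[0],\dots,M[N]$ described in the context, started in $M[0]$. Let $y_k$ be the expected number of arrivals in $M[k]$, $k=0,1,\dots,N$. Then $y_k$ $(k=0,1,\dots,N)$ is the unique solution of the linear system $$\sum_{j=0}^{N}u_{ij}y_j=-\delta(i,0)\qquad (i=0,1,\dots,N),$$ where, writing $\rho=\rho[i,j]$ and $n=n[i,j]$ for the parameters of the edge between $M[i]$ and $M[j]$ (so $\rho,n$ depend on the pair $\{i,j\}$), $$u_{ij}=\left[\frac{(1-\rho)\rho^n}{1-\rho^{n+1}}\right]p^*_{[j,i]}\quad (j<i,\ \rho\neq 1),$$ $$u_{ij}=\left[\frac{1-\rho}{1-\rho^{n+1}}\right]p^*_{[j,i]}\quad (j>i,\ \rho\neq 1),$$ $$u_{ij}=\frac{p^*_{[j,i]}}{n+1}\quad (j\neq i,\ \rho=1),$$ $$u_{ii}=-1+\sum_{j<i,\ \rho\neq 1}\left[\frac{\rho(1-\rho^n)}{1-\rho^{n+1}}\right]p^*_{[i,j]}+\sum_{j>i,\ \rho\neq 1}\left[\frac{1-\rho^n}{1-\rho^{n+1}}\right]p^*_{[i,j]}+\sum_{j\neq i,\ \rho=1}\left[\frac{n}{n+1}\right]p^*_{[i,j]}.$$ Here $\delta(i,0)=1$ if $i=0$ and $0$ otherwise.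
   Context: Setting. A finite graph has vertices (multiple function barriers) $M[0],\dots,M[N]$. For $i<j$ the edge between $M[i]$ and $M[j]$ carries a finite number $n[i,j]$ of intermediate states, numbered $1,2,\dots,n[i,j]$ in the direction from $M[i]$ to $M[j]$; on this edge position $0$ is $M[i]$ and position $n[i,j]+1$ is $M[j]$. Each edge has parameters $p=p[i,j]$ (one-step forward probability) and $q=q[i,j]$ (one-step backward probability) with $p+q=1$ and $p[i,j]\,q[i,j]>0$, and $\rho[i,j]=p[i,j]/q[i,j]$. Edge parameters belong to the unordered pair: $n[j,i]=n[i,j]$, $p[j,i]=p[i,j]$, $q[j,i]=q[i,j]$, $\rho[j,i]=\rho[i,j]$, ''forward'' always meaning from the smaller-index to the larger-index vertex. The discrete-time walk moves as follows. From intermediate state $k$ of an edge it moves to position $k+1$ of that edge with probability $p$ and to position $k-1$ with probability $q$. From $M[i]$ it moves, with probability $p^*_{[i,j]}$ ($j\ne i$), one step in the direction of $M[j]$ (to position $1$ of the edge if $i<j$, to position $n[i,j]$ if $i>j$), and with probability $p^*_{[i,i]}$ it is absorbed in $M[i]$. Here $\sum_{j=0}^N p^*_{[i,j]}=1$ for every $i=0,\dots,N$. (Pairs not joined by an edge have $p^*_{[i,j]}=p^*_{[j,i]}=0$.) An absorbed particle makes no further arrivals. The expected number of arrivals in a state $s$ is $\sum_{m=0}^\infty P(\text{the particle is in } s \text{ after } m \text{ steps})$; the time-$0$ presence in the starting state is counted.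
   Formalization: It is additionally assumed that from every M[i] some M[j] with p*_{[j,j]}>0 can be reached through barriers along positive p*; otherwise the matrix (u_ij) is singular and the solution is not unique (e.g. N=1, p*_{[0,1]}=p*_{[1,0]}=1). *)

(* Defs.v *)
From HB Require Import structures.
From mathcomp Require Import all_boot all_order all_algebra.
From mathcomp Require Import all_classical all_reals all_analysis.

Set Implicit Arguments.
Unset Strict Implicit.
Unset Printing Implicit Defensive.

Import Order.TTheory GRing.Theory Num.Theory.

Local Open Scope classical_set_scope.
Local Open Scope ring_scope.

(* Edge data are indexed by ordered pairs but constrained only on edges; the
   values they take at a pair that is not an edge play no role, since [pstar]
   vanishes there. *)
Record barrier_graph (R : realType) (N : nat) := BarrierGraph {
  edge : rel 'I_N.+1;
  len : 'I_N.+1 -> 'I_N.+1 -> nat;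
  fwd : 'I_N.+1 -> 'I_N.+1 -> R;
  bwd : 'I_N.+1 -> 'I_N.+1 -> R;
  pstar : 'I_N.+1 -> 'I_N.+1 -> R;
  edge_irr : irreflexive edge;
  edge_sym : symmetric edge;
  len_sym : forall i j, edge i j -> len j i = len i j;
  fwd_sym : forall i j, edge i j -> fwd j i = fwd i j;
  bwd_sym : forall i j, edge i j -> bwd j i = bwd i j;
  fwdDbwd : forall i j, edge i j -> fwd i j + bwd i j = 1;
  fwdMbwd_gt0 : forall i j, edge i j -> 0 < fwd i j * bwd i j;
  pstar_ge0 : forall i j, 0 <= pstar i j;
  pstar_sum : forall i, \sum_(j < N.+1) pstar i j = 1;
  pstar_nonedge : forall i j, i != j -> ~~ edge i j -> pstar i j = 0
}.

Section Walk.
Context (R : realType) (N : nat) (G : barrier_graph R N).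

Definition rho (i j : 'I_N.+1) : R := fwd G i j / bwd G i j.

(* Every edge is listed once, as the pair whose first component is smaller. *)
Definition inner_size (e : 'I_N.+1 * 'I_N.+1) : nat :=
  if edge G e.1 e.2 && (e.1 < e.2)%N then len G e.1 e.2 else 0.

(* [Inner e k] is the intermediate state at position k + 1 of the edge e.
   [Absorbed i] is kept apart from [Barrier i], so that a particle absorbed in
   M[i] is no longer counted as arriving there. *)
Inductive state : Type :=
| Barrier of 'I_N.+1
| Absorbed of 'I_N.+1
| Inner (e : 'I_N.+1 * 'I_N.+1) of 'I_(inner_size e).

Definition state_code (s : state) :
    'I_N.+1 + 'I_N.+1 + {e : 'I_N.+1 * 'I_N.+1 & 'I_(inner_size e)} :=
  match s with
  | Barrier i => inl (inl i)
  | Absorbed i => inl (inr i)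
  | Inner e k => inr (Tagged (fun e => 'I_(inner_size e)) k)
  end.

Definition state_decode
    (c : 'I_N.+1 + 'I_N.+1 + {e : 'I_N.+1 * 'I_N.+1 & 'I_(inner_size e)}) :
    state :=
  match c with
  | inl (inl i) => Barrier i
  | inl (inr i) => Absorbed i
  | inr u => Inner (tagged u)
  end.

Lemma state_codeK : cancel state_code state_decode.
Proof. by case. Qed.

HB.instance Definition _ := Finite.copy state (can_type state_codeK).

(* Position l of the edge {i, j}, for i < j and l <= len G i j + 1. *)
Definition position (i j : 'I_N.+1) (l : nat) : state :=
  if l is l'.+1 then
    if @insub nat (fun k => k < inner_size (i, j))%N _ l' is Some k
    then @Inner (i, j) k else Barrier j
  else Barrier i.

Definition toward (i j : 'I_N.+1) : state :=
  if (i < j)%N then position i j 1 else position j i (len G i j).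

Definition step (s t : state) : R :=
  match s with
  | Barrier i =>
      pstar G i i * (t == Absorbed i)%:R
      + \sum_(j < N.+1 | j != i) pstar G i j * (t == toward i j)%:R
  | Absorbed i => (t == Absorbed i)%:R
  | Inner e k =>
      fwd G e.1 e.2 * (t == position e.1 e.2 k.+2)%:R
      + bwd G e.1 e.2 * (t == position e.1 e.2 k)%:R
  end.

Definition is_walk (d : measure_display) (T : measurableType d)
    (P : probability T R) (s0 : state) (X : nat -> T -> state) : Prop :=
  [/\ forall m s, measurable (X m @^-1` [set s]),
      P (X 0%N @^-1` [set s0]) = 1%E &
      forall m (s : nat -> state),
        P [set w | forall l, (l <= m.+1)%N -> X l w = s l] =
        (P [set w | forall l, (l <= m)%N -> X l w = s l]
         * (step (s m) (s m.+1))%:E)%E].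

Definition expected_arrivals (d : measure_display) (T : measurableType d)
    (P : probability T R) (X : nat -> T -> state) (s : state) : \bar R :=
  (\sum_(0 <= m <oo) P (X m @^-1` [set s]))%E.

(* When this fails, expected numbers of arrivals may be infinite and the matrix
   of coefficients [u] below is singular. *)
Definition absorption_accessible : Prop :=
  forall i : 'I_N.+1,
    exists2 j, connect [rel a b | 0 < pstar G a b] i j & 0 < pstar G j j.

Definition u (i j : 'I_N.+1) : R :=
  let r := rho i j in
  let n := len G i j in
  if j == i then
    -1
    + \sum_(k < N.+1 | (k < i)%N && (rho i k != 1))
        rho i k * (1 - rho i k ^+ len G i k) / (1 - rho i k ^+ (len G i k).+1)
        * pstar G i k
    + \sum_(k < N.+1 | (i < k)%N && (rho i k != 1))
        (1 - rho i k ^+ len G i k) / (1 - rho i k ^+ (len G i k).+1)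
        * pstar G i k
    + \sum_(k < N.+1 | (k != i) && (rho i k == 1))
        (len G i k)%:R / (len G i k).+1%:R * pstar G i k
  else if r == 1 then pstar G j i / n.+1%:R
  else if (j < i)%N then (1 - r) * r ^+ n / (1 - r ^+ n.+1) * pstar G j i
  else (1 - r) / (1 - r ^+ n.+1) * pstar G j i.

Definition solves (y : 'I_N.+1 -> R) : Prop :=
  forall i : 'I_N.+1, \sum_(j < N.+1) u i j * y j = - (i == ord0)%:R.

End Walk.

Arguments Barrier {R N} G.
Arguments Absorbed {R N} G.

(* Main.v *)
Require Import Defs.
From mathcomp Require Import all_boot all_order all_algebra.
From mathcomp Require Import all_classical all_reals all_analysis.
From mathcomp Require Import ring lra.

(* Let x_m be the law of the walk at time m, and let a function c on the
   barriers be extended to all states by the gambler's-ruin interpolation along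
   each edge and by 0 on the absorbed states. One step of the walk changes the
   mean of this extension only through the barriers, by
   sum_k x_m(M[k]) sum_i c_i u_ik. Summing over m < M and letting M tend to
   infinity with c the indicator of M[i] gives the system.
   The passage to the limit needs the expected numbers of visits to be finite.
   By a minimum principle, which is where accessibility of absorption is used,
   the matrix u is invertible; so some c satisfies sum_i c_i u_ik = -1 for all
   k. Its extension, combined with a function that decreases in mean inside the
   edges, decreases in mean by a positive amount at each state that is not
   absorbed. Invertibility of u also gives uniqueness. *)

Set Implicit Arguments.
Unset Strict Implicit.
Unset Printing Implicit Defensive.

Import Order.TTheory GRing.Theory Num.Theory.
Import numFieldNormedType.Exports.

Local Open Scope classical_set_scope.
Local Open Scope ring_scope.

(** * Occupation probabilities and their one-step recursion *)

Lemma measure_fin_partition (R : realType) (d : measure_display)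
    (T : measurableType d) (mu : {measure set T -> \bar R}) (F : finType)
    (Y : T -> F) (B : set T) :
  measurable B -> (forall f, measurable (Y @^-1` [set f])) ->
  mu B = (\sum_(f : F) mu (B `&` Y @^-1` [set f]))%E.
Proof.
move=> mB mY.
have {1}-> : B = \bigcup_(f in setT) (B `&` Y @^-1` [set f]).
  by apply/seteqP; split=> [w Bw|w [f _ []]//]; exists (Y w).
rewrite measure_fin_bigcup;
  [|exact: finite_finset|exact: trivIset_preimage1_in|].
  rewrite (fsbigE (index_enum F)) ?index_enum_uniq//=; last first.
    by move=> f _; rewrite mem_index_enum.
  by apply: eq_bigl => f; rewrite in_setT.
by move=> f _; exact: measurableI.
Qed.

Section Law.
Context (R : realType) (N : nat) (G : barrier_graph R N).
Context (d : measure_display) (T : measurableType d) (P : probability T R).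
Context (s0 : state G) (X : nat -> T -> state G) (hX : is_walk P s0 X).

Definition occ (m : nat) (s : state G) : R := fine (P (X m @^-1` [set s])).

Lemma measurable_walk m s : measurable (X m @^-1` [set s]).
Proof. by case: hX. Qed.

Lemma occE m s : P (X m @^-1` [set s]) = (occ m s)%:E.
Proof. by rewrite /occ fineK// fin_num_measure//; exact: measurable_walk. Qed.

Lemma occ_ge0 m s : 0 <= occ m s.
Proof. by rewrite -lee_fin -occE. Qed.

Lemma occ0 s : occ 0 s = (s == s0)%:R.
Proof.
have [_ h0 _] := hX; case: eqVneq => [->|ne]; apply: EFin_inj; rewrite -occE//.
apply/eqP; rewrite eq_le measure_ge0 andbT.
have -> : 0%:E = P (~` (X 0 @^-1` [set s0])).
  by rewrite probability_setC ?h0 ?subee//; exact: measurable_walk.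
apply: le_measure; rewrite ?inE; [exact: measurable_walk| |].
  exact: measurableC (measurable_walk _ _).
by move=> w /= -> /eqP; exact: negP ne.
Qed.

Definition history m (w : T) : {ffun 'I_m.+1 -> state G} :=
  [ffun l => X (val l) w].

Lemma history_preimage m (f : {ffun 'I_m.+1 -> state G}) :
  history m @^-1` [set f] =
  [set w | forall l, (l <= m)%N -> X l w = f (inord l)].
Proof.
apply/seteqP; split=> w /=; first by move=> <- l lm; rewrite ffunE /= inordK.
move=> h; apply/ffunP => l.
by rewrite ffunE h ?inord_val// -ltnS; exact: ltn_ord.
Qed.

Lemma measurable_history m (f : {ffun 'I_m.+1 -> state G}) :
  measurable (history m @^-1` [set f]).
Proof.
have -> : history m @^-1` [set f] =
    \bigcap_(l in setT) (X (val l) @^-1` [set f l]).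
  apply/seteqP; split=> w /=; first by move=> <- l _ /=; rewrite ffunE.
  by move=> h; apply/ffunP => l; rewrite ffunE; exact: (h l).
apply: fin_bigcap_measurable; first exact: finite_finset.
by move=> l _; exact: measurable_walk.
Qed.

(** [is_walk] speaks of whole trajectories only, so both sides are split over the finitely many
    histories up to time m. *)
Lemma occS m t : occ m.+1 t = \sum_s occ m s * step s t.
Proof.
have [mX _ hS] := hX; apply: EFin_inj; rewrite -occE -sumEFin.
have mH := @measurable_history m.
rewrite (measure_fin_partition _ (measurable_walk m.+1 t) mH).
under [RHS]eq_bigr => s _.
  rewrite EFinM -occE (measure_fin_partition _ (measurable_walk m s) mH).
  rewrite ge0_sume_distrl//.
  over.
rewrite exchange_big/=; apply: eq_bigr => f _.
rewrite (bigD1 (f ord_max))//= big1 ?adde0.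
  have -> : X m @^-1` [set f ord_max] `&` history m @^-1` [set f] =
      history m @^-1` [set f].
    by apply/seteqP; split=> w /= => [[]//|<-]; split=> //; rewrite ffunE.
  (* The history f prolonged by t at time m + 1, the form in which [hS] applies. *)
  pose g l := if (l <= m)%N then f (inord l) else t.
  have gm : g m = f ord_max.
    by rewrite /g leqnn; congr (f _); apply: val_inj; rewrite /= inordK.
  have gm1 : g m.+1 = t by rewrite /g ltnn.
  have -> : history m @^-1` [set f] =
      [set w | forall l, (l <= m)%N -> X l w = g l].
    rewrite history_preimage; apply/seteqP; split=> w /= h l lm.
      by rewrite h// /g lm.
    by rewrite h// /g lm.
  rewrite -gm -[in X in step _ X]gm1 -hS; congr (P _).
  apply/seteqP; split=> w /=.
    move=> [Xt h] l; rewrite leq_eqVlt => /predU1P[->|]; last exact: h.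
    by rewrite Xt gm1.
  by move=> h; split=> [|l lm]; [rewrite h|rewrite h// (leq_trans lm)].
move=> s /eqP sf; suff -> :
    X m @^-1` [set s] `&` history m @^-1` [set f] = set0.
  by rewrite measure0 mul0e.
rewrite -subset0 => w /= [Xs fw].
by apply: sf; rewrite -Xs -fw ffunE.

Qed.
End Law.

(** * The transition operator on functions of the state *)

Section Generator.
Context (R : realType) (N : nat) (G : barrier_graph R N).
Implicit Types (g : state G -> R) (c : 'I_N.+1 -> R) (i j k : 'I_N.+1).

Lemma fwd_bwd_gt0 i j : edge G i j -> (0 < fwd G i j) && (0 < bwd G i j).
Proof.
move=> ij; have := fwdDbwd ij; have := fwdMbwd_gt0 ij.
move: (fwd G i j) (bwd G i j) => p q pq p1; apply/andP; split; nra.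
Qed.

Lemma pstar_neq0_edge i j : i != j -> pstar G i j != 0 -> edge G i j.
Proof. by move=> ij; apply: contraNT => /(pstar_nonedge ij)->. Qed.

Lemma pstar_offdiag k : \sum_(j < N.+1 | j != k) pstar G k j = 1 - pstar G k k.
Proof. by rewrite -(pstar_sum G k) [in RHS](bigD1 k)//= addrAC subrr add0r. Qed.

(** The mean of g after one step from s; the drift of g is [gen g s - g s]. *)
Definition gen g s : R := \sum_t step s t * g t.

Lemma sum_pred1 (S : finType) (g : S -> R) x : \sum_t (t == x)%:R * g t = g x.
Proof.
rewrite (bigD1 x)//= eqxx mul1r big1 ?addr0// => t /negbTE->.
by rewrite mul0r.
Qed.

Lemma gen_Absorbed g i : gen g (Absorbed G i) = g (Absorbed G i).
Proof. exact: sum_pred1. Qed.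

Lemma gen_Inner g e (k : 'I_(inner_size G e)) :
  gen g (Inner k) = fwd G e.1 e.2 * g (position G e.1 e.2 k.+2)
                    + bwd G e.1 e.2 * g (position G e.1 e.2 k).
Proof.
rewrite /gen /=; under eq_bigr do rewrite mulrDl -!mulrA.
by rewrite big_split/= -!mulr_sumr !sum_pred1.
Qed.

Lemma gen_Barrier g i :
  gen g (Barrier G i) = pstar G i i * g (Absorbed G i)
    + \sum_(j < N.+1 | j != i) pstar G i j * g (toward G i j).
Proof.
rewrite /gen /=; under eq_bigr do rewrite mulrDl -mulrA mulr_suml.
rewrite big_split/= -mulr_sumr sum_pred1 exchange_big/=; congr (_ + _).
apply: eq_bigr => j _; under eq_bigr do rewrite -mulrA.
by rewrite -mulr_sumr sum_pred1.
Qed.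

(** * Gambler's-ruin interpolation along an edge *)

Definition ratio (i j : 'I_N.+1) : R := bwd G i j / fwd G i j.

(** Kept as a sum rather than a quotient, so that t = 1 is no special case. *)
Definition geom (t : R) (n : nat) : R := \sum_(m < n) t ^+ m.

(* Probability that the walk reaches M[j] before M[i] from position [l] of the
   edge, for i < j. *)
Definition ruin (i j : 'I_N.+1) (l : nat) : R :=
  geom (ratio i j) l / geom (ratio i j) (len G i j).+1.

Definition hext c (s : state G) : R :=
  match s with
  | Barrier i => c i
  | Absorbed _ => 0
  | Inner e k => c e.1 + (c e.2 - c e.1) * ruin e.1 e.2 k.+1
  end.

(* Probability that a particle leaving M[i] towards M[j] reaches M[j] before
   coming back to M[i]. *)
Definition hit (i j : 'I_N.+1) : R :=
  (if (i < j)%N then 1 else ratio i j ^+ len G i j)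
  / geom (ratio i j) (len G i j).+1.

Lemma ratio_gt0 i j : edge G i j -> 0 < ratio i j.
Proof. by move=> /fwd_bwd_gt0/andP[? ?]; rewrite divr_gt0. Qed.

Lemma geomS t n : geom t n.+1 = geom t n + t ^+ n.
Proof. by rewrite /geom big_ord_recr. Qed.

Lemma geom_gt0 t n : 0 < t -> 0 < geom t n.+1.
Proof.
move=> t0; rewrite /geom big_ord_recl expr0 ltr_pwDl//.
by apply: sumr_ge0 => m _; rewrite exprn_ge0// ltW.
Qed.

Lemma hit_gt0 i j : edge G i j -> 0 < hit i j.
Proof.
move=> ij; have t0 := ratio_gt0 ij; rewrite divr_gt0 ?geom_gt0//.
by case: ifP => // _; rewrite exprn_gt0.
Qed.

Lemma inner_sizeE i j : edge G i j -> (i < j)%N ->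
  inner_size G (i, j) = len G i j.
Proof. by rewrite /inner_size /= => -> ->. Qed.

Lemma Inner_edge e (k : 'I_(inner_size G e)) :
  [/\ edge G e.1 e.2, (e.1 < e.2)%N & (k < len G e.1 e.2)%N].
Proof.
have := ltn_ord k; rewrite {2}/inner_size; case: ifP => // /andP[? ?] ?.
by split.
Qed.

Lemma hext_position c i j l :
  edge G i j -> (i < j)%N -> (l <= (len G i j).+1)%N ->
  hext c (position G i j l) = c i + (c j - c i) * ruin i j l.
Proof.
move=> ij ltij; case: l => [|l] lel /=.
  by rewrite /ruin /geom big_ord0 mul0r mulr0 addr0.
case: insubP => [k _ kl|] /=; first by rewrite -kl.
(* [insub] fails only at the far end of the edge, where [position] is M[j] and [ruin] is 1. *)
rewrite inner_sizeE// -leqNgt => nl.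
have -> : l = len G i j by apply/eqP; rewrite eqn_leq nl andbT.
rewrite /ruin divff ?mulr1; first by ring.
by rewrite gt_eqF// geom_gt0// ratio_gt0.
Qed.

Lemma hext_toward c i j : edge G i j ->
  hext c (toward G i j) = c i + (c j - c i) * hit i j.
Proof.
move=> ij; rewrite /toward /hit; case: ltngtP => [lt|lt|/val_inj eij].
- by rewrite hext_position// /ruin {1}/geom big_ord1 expr0.
(* The step leads to the last inner position of the edge from M[j]; there 1 - [ruin] is the top term
   of the geometric sum divided by the sum. *)
- rewrite edge_sym in ij; rewrite hext_position ?(len_sym ij)//.
  rewrite /ruin /ratio (bwd_sym ij) (fwd_sym ij) -/(ratio j i).
  have : geom (ratio j i) (len G j i).+1 != 0.
    by rewrite gt_eqF// geom_gt0// ratio_gt0.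
  rewrite geomS => S0; field.
  exact: S0.
- by move: ij; rewrite eij edge_irr.
Qed.

(** The increments of [ruin] are proportional to powers of q/p, and the forward gain p (q/p)^(k+1)
    equals the backward loss q (q/p)^k. *)
Lemma gen_hext_Inner c e (k : 'I_(inner_size G e)) :
  gen (hext c) (Inner k) = hext c (Inner k).
Proof.
have [e12 lt12 kn] := Inner_edge k; have /andP[p0 q0] := fwd_bwd_gt0 e12.
rewrite gen_Inner !hext_position//=; last by rewrite ltnW// ltnW.
have q_tp : bwd G e.1 e.2 = ratio e.1 e.2 * fwd G e.1 e.2.
  by rewrite /ratio divfK// gt_eqF.
have := fwdDbwd e12; rewrite q_tp => pD.
rewrite -[RHS]mul1r -pD /ruin [geom _ k.+2]geomS.
rewrite [geom _ k.+1]geomS [_ ^+ k.+1]exprS.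
by ring.
Qed.

Lemma gen_hext_Barrier c k :
  gen (hext c) (Barrier G k) = c k - pstar G k k * c k
    + \sum_(j < N.+1 | j != k) pstar G k j * hit k j * (c j - c k).
Proof.
rewrite gen_Barrier /= mulr0 add0r.
have -> : c k - pstar G k k * c k = \sum_(j < N.+1 | j != k) pstar G k j * c k.
  by rewrite -mulr_suml pstar_offdiag mulrBl mul1r.
rewrite -big_split/=; apply: eq_bigr => j jk.
have [->|p0] := eqVneq (pstar G k j) 0; first by rewrite !mul0r addr0.
rewrite hext_toward; first by ring.
by apply: pstar_neq0_edge p0; rewrite eq_sym.
Qed.

(** * The coefficients of the system as drifts at the barriers *)

Lemma rho_gt0 i j : edge G i j -> 0 < rho G i j.
Proof. by move=> /fwd_bwd_gt0/andP[? ?]; rewrite divr_gt0. Qed.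

Lemma rho_sym i j : edge G i j -> rho G j i = rho G i j.
Proof. by move=> ij; rewrite /rho fwd_sym// bwd_sym. Qed.

Lemma hitE i j (r := rho G i j) (n := len G i j) : edge G i j ->
  hit i j = if r == 1 then n.+1%:R^-1
            else if (i < j)%N then (1 - r) * r ^+ n / (1 - r ^+ n.+1)
            else (1 - r) / (1 - r ^+ n.+1).
Proof.
move=> ij; have r_gt0 : 0 < r := rho_gt0 ij; have r0 := lt0r_neq0 r_gt0.
have rt : ratio i j = r^-1 by rewrite /r /rho invf_div.
rewrite /hit rt -/n; case: eqP => [->|/eqP r1].
  rewrite invr1 !expr1n if_same mul1r /geom; under eq_bigr do rewrite expr1n.
  by rewrite sumr_const card_ord.
have t1 : r^-1 - 1 != 0 by rewrite subr_eq0 invr_eq1.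
have -> : geom r^-1 n.+1 = (r^-1 ^+ n.+1 - 1) / (r^-1 - 1).
  by rewrite subrX1 mulrC mulKf.
have rn0 : r ^+ n != 0 by rewrite expf_neq0.
have d1 : 1 + -1 * r != 0 by rewrite mulN1r subr_eq0 eq_sym.
(* A positive number other than 1 has no positive power equal to 1. *)
have dn : 1 - r * r ^+ n != 0.
  by rewrite -exprS subr_eq0 eq_sym pexpr_eq1// ltW.
rewrite !exprVn exprS; have : (r * r ^+ n)^-1 - 1 != 0.
  by rewrite subr_eq0 invr_eq1 eq_sym -subr_eq0.
by case: ifP => _ ?; field; apply/and4P; split.
Qed.

(** Column j of [u] describes departures from M[j]. Off the edges [pstar] vanishes, so the closed
    form of [hit] is needed on edges only. *)
Lemma u_offdiag i j : j != i -> u G i j = pstar G j i * hit j i.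
Proof.
move=> ji; rewrite /u (negbTE ji).
have [->|p0] := eqVneq (pstar G j i) 0; first by rewrite !mul0r !mulr0 !if_same.
have e := pstar_neq0_edge ji p0; rewrite (hitE e) -(rho_sym e) -(len_sym e).
by case: ifP => // _; rewrite [RHS]mulrC; case: ifP.
Qed.

(** The three sums have disjoint ranges, and each bracket is the probability 1 - [hit] of coming
    back to M[i] first. *)
Lemma u_diag i :
  u G i i = -1 + \sum_(k < N.+1 | k != i) pstar G i k * (1 - hit i k).
Proof.
rewrite /u eqxx -!addrA; congr (_ + _).
rewrite [X in X + _]big_mkcond [X in _ + (X + _)]big_mkcond.
rewrite [X in _ + (_ + X)]big_mkcond [RHS]big_mkcond -!big_split/=.
apply: eq_bigr => k _; have [->|p0] := eqVneq (pstar G i k) 0.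
  by rewrite !mulr0 mul0r !if_same !addr0.
have [->|ki] := eqVneq k i; first by rewrite ltnn !addr0.
have e : edge G i k by apply: pstar_neq0_edge p0; rewrite eq_sym.
have r_gt0 := rho_gt0 e; rewrite hitE//.
move: (rho G i k) (len G i k) (pstar G i k) r_gt0 => r n p r_gt0.
have [->|r1] /= := eqVneq r 1.
  by rewrite !andbF !add0r; field; rewrite -[1]/(1%:R) -natrD pnatr_eq0.
have dn : 1 - r * r ^+ n != 0.
  by rewrite -exprS subr_eq0 eq_sym pexpr_eq1// ltW.
rewrite !andbT addr0 exprS; case: ltngtP => [lt|lt|/val_inj eki].
- by rewrite addr0; field.
- by rewrite add0r; field.
- by rewrite eki eqxx in ki.
Qed.

(** This ties the coefficients to the walk: the transpose of [u] sends c to the drift of its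
    extension at the barriers. *)
Lemma sum_u c k : \sum_i c i * u G i k = gen (hext c) (Barrier G k) - c k.
Proof.
rewrite gen_hext_Barrier (bigD1 k)//= u_diag.
under [X in _ + X]eq_bigr => i ik do rewrite u_offdiag 1?eq_sym//.
have -> : \sum_(j | j != k) pstar G k j * (1 - hit k j)
    = 1 - pstar G k k - \sum_(j | j != k) pstar G k j * hit k j.
  by rewrite -pstar_offdiag -sumrB; apply: eq_bigr => j _; ring.
have -> : \sum_(j | j != k) pstar G k j * hit k j * (c j - c k)
    = \sum_(j | j != k) c j * (pstar G k j * hit k j)
      - c k * \sum_(j | j != k) pstar G k j * hit k j.
  by rewrite mulr_sumr -sumrB; apply: eq_bigr => j _; ring.
by ring.
Qed.

(* At a negative minimum, the inequality forces zero absorption probability and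
   the same value at all accessible barriers. *)
Lemma supermedian_ge0 c : absorption_accessible G ->
  (forall k, gen (hext c) (Barrier G k) <= c k) -> forall k, 0 <= c k.
Proof.
move=> habs hc k.
case: (@arg_minP _ _ _ k predT c isT) => k0 _ kmin.
apply: le_trans (kmin k isT); rewrite leNgt; apply/negP => m0.
pose A := [pred j | c j == c k0].
have stepA j : j \in A -> pstar G j j = 0
    /\ forall l, 0 < pstar G j l -> l \in A.
  rewrite inE => /eqP jk0; have := hc j.
  rewrite gen_hext_Barrier jk0 -addrA gerDl => drift.
  have p_ge0 : 0 <= - (pstar G j j * c k0).
    by rewrite oppr_ge0 mulr_ge0_le0 ?pstar_ge0// ltW.
  have t_ge0 l : l != j -> 0 <= pstar G j l * hit j l * (c l - c k0).
    move=> lj; have [->|p0] := eqVneq (pstar G j l) 0; first by rewrite !mul0r.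
    rewrite mulr_ge0 ?subr_ge0 ?kmin// mulr_ge0 ?pstar_ge0//.
    by apply/ltW/hit_gt0/(pstar_neq0_edge _ p0); rewrite eq_sym.
  have sum_ge0 := sumr_ge0 _ t_ge0; move: drift.
  rewrite le_eqVlt ltNge addr_ge0// orbF paddr_eq0// => /andP[].
  rewrite oppr_eq0 mulf_eq0 (lt_eqF m0) orbF => /eqP pjj /eqP sum0.
  split=> // l pl; rewrite inE; have [->|lj] := eqVneq l j; first exact/eqP.
  have h0 : 0 < hit j l.
    by apply/hit_gt0/(pstar_neq0_edge _ (lt0r_neq0 pl)); rewrite eq_sym.
  have /eqP := psumr_eq0P t_ge0 sum0 lj.
  by rewrite mulf_eq0 (gt_eqF (mulr_gt0 pl h0)) subr_eq0.
have [j /connectP[s ps ->] pj] := habs k0.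
have : last k0 s \in A.
  have : k0 \in A by rewrite inE.
  elim: s (k0) ps {pj j} => //= x s IH y /andP[yx px] yA.
  by apply: IH => //; exact: (stepA y yA).2.
by move=> /stepA[]; move: pj => /[swap]-> ; rewrite ltxx.
Qed.
End Generator.

(** * Invertibility of the matrix, and a function with negative drift *)

Section Potential.
Context (R : realType) (N : nat) (G : barrier_graph R N).

Lemma gen_linear (a : R) (g h : state G -> R) s :
  gen (fun t => a * g t + h t) s = a * gen g s + gen h s.
Proof.
by rewrite /gen mulr_sumr -big_split/=; apply: eq_bigr => t _; ring.
Qed.

(** A row vector killed by [u] has an extension without drift at the barriers, so the minimum
    principle applies to it and to its opposite. *)
Lemma u_unitmx : absorption_accessible G ->
  (\matrix_(i, j) u G i j) \in unitmx.
Proof.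
move=> habs; rewrite -row_free_unit; apply: inj_row_free => v v0.
have gen_v k : \sum_i v ord0 i * u G i k = 0.
  have /matrixP/(_ ord0 k) := v0; rewrite !mxE => {2}<-.
  by apply: eq_bigr => i _; rewrite mxE.
apply/rowP => k; rewrite mxE; apply/eqP; rewrite eq_le -oppr_ge0.
apply/andP; split.
  apply: (supermedian_ge0 (c := fun i => - v ord0 i)) => // l.
  rewrite -subr_le0 -sum_u; under eq_bigr do rewrite mulNr.
  by rewrite sumrN gen_v oppr0.
apply: (supermedian_ge0 (c := fun i => v ord0 i)) => // l.
by rewrite -subr_le0 -sum_u gen_v.
Qed.

Lemma exists_barrier_potential : absorption_accessible G ->
  exists c : 'I_N.+1 -> R, forall k, \sum_i c i * u G i k = -1.
Proof.
move=> /u_unitmx; set U := \matrix_(i, j) _ => Uunit.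
pose v : 'rV[R]_N.+1 := const_mx (-1) *m invmx U.
exists (v ord0) => k; have /matrixP/(_ ord0 k) : v *m U = const_mx (-1).
  by rewrite /v mulmxKV.
rewrite [LHS]mxE [RHS]mxE => <-.
by apply: eq_bigr => i _; rewrite [U i k]mxE.
Qed.

(* [(1 / fwd) ^+ l] is strictly subharmonic in the position l of an edge. *)
Definition edge_potential (s : state G) : R :=
  if s is Inner e k then
    (fwd G e.1 e.2)^-1 ^+ (len G e.1 e.2).+1 - (fwd G e.1 e.2)^-1 ^+ k.+1
  else 0.

(** Equality can fail only at position 0, where the potential is 0 and the formula is nonnegative
    because 1 / [fwd] is at least 1. *)
Lemma edge_potential_position i j l :
  edge G i j -> (i < j)%N -> (l <= (len G i j).+1)%N ->
  edge_potential (position G i j l)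
    <= (fwd G i j)^-1 ^+ (len G i j).+1 - (fwd G i j)^-1 ^+ l.
Proof.
move=> ij ltij; have /andP[p0 q0] := fwd_bwd_gt0 ij.
have p1 : 1 <= (fwd G i j)^-1 by rewrite invf_ge1// -(fwdDbwd ij) lerDl ltW.
case: l => [|l] lel /=; first by rewrite subr_ge0 expr0 exprn_ege1.
case: insubP => [k _ kl|] /=; first by rewrite -kl.
rewrite inner_sizeE// -leqNgt => nl.
have -> : l = len G i j by apply/eqP; rewrite eqn_leq nl andbT.
by rewrite subrr.
Qed.

(** With t = 1/p, the mean of t^l after a step from l = k + 1 is t^(k+1) + q t^k, and the excess q
    t^k is at least q, hence at least p q. *)
Lemma gen_edge_potential_Inner e (k : 'I_(inner_size G e)) :
  gen edge_potential (Inner k) <= edge_potential (Inner k)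
    - fwd G e.1 e.2 * bwd G e.1 e.2.
Proof.
have [e12 lt12 kn] := Inner_edge k; have /andP[p0 q0] := fwd_bwd_gt0 e12.
have kn' : (k <= (len G e.1 e.2).+1)%N by rewrite ltnW// ltnW.
have := edge_potential_position e12 lt12 kn'.
have := edge_potential_position e12 lt12 (kn : (k.+2 <= _.+1)%N).
have b1 : 1 <= (fwd G e.1 e.2)^-1 ^+ k.
  by rewrite exprn_ege1// invf_ge1// -(fwdDbwd e12) lerDl ltW.
have pt : fwd G e.1 e.2 * (fwd G e.1 e.2)^-1 = 1 by rewrite mulfV// gt_eqF.
have pq := fwdDbwd e12.
rewrite gen_Inner [edge_potential (Inner k)]/= (exprS _ k.+1) (exprS _ k).
set B := _ ^+ _.+1; set b := _ ^+ k in b1 *; set t := _^-1 in pt *.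
move: p0 q0 b1 pt pq.
set p := fwd _ _ _; set q := bwd _ _ _ => p0 q0 b1 pt pq hk hk2.
have -> : B - t * b - p * q
  = (q * (B - b)) + p * (B - t * (t * b)) + q * (b - p).
  have -> : q = 1 - p by rewrite -pq addrC addKr.
  have -> : p * (B - t * (t * b)) = p * B - p * t * (t * b) by ring.
  by rewrite pt; ring.
rewrite -[leLHS]addr0 lerD//; first by rewrite addrC lerD// ler_pM2l.
by rewrite mulr_ge0 ?(ltW q0)// subr_ge0 (le_trans _ b1)// -pq lerDl ltW.
Qed.

Lemma exists_potential : absorption_accessible G ->
  exists V w : state G -> R,
    [/\ forall i, w (Absorbed G i) = 0, forall s, 0 <= w s,
        (forall s, (forall i, s <> Absorbed G i) -> 0 < w s) &
        forall s, gen V s <= V s - w s].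
Proof.
move=> /exists_barrier_potential[c hc].
(* C bounds the mean gain of [edge_potential] at any barrier, so the weight C + 1 on [hext c], whose
   drift there is -1, leaves a drop of at least 1. *)
pose C := \sum_k `|gen edge_potential (Barrier G k)|.
exists (fun s => (C + 1) * hext c s + edge_potential s).
exists (fun s => match s with Barrier _ => 1 | Absorbed _ => 0
  | Inner e _ => fwd G e.1 e.2 * bwd G e.1 e.2 end).
split=> [//|[//|//|e k]|[//|i /(_ i)//|e k _]|s].
- by have [/fwdMbwd_gt0/ltW] := Inner_edge k.
- by have [/fwdMbwd_gt0] := Inner_edge k.
rewrite gen_linear; case: s => [k|i|e k].
- have -> : gen (hext c) (Barrier G k) = c k - 1.
    by have := sum_u G c k; rewrite hc; lra.
  have : gen edge_potential (Barrier G k) <= C.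
    rewrite (le_trans (ler_norm _))// /C (bigD1 k)//= lerDl.
    by apply: sumr_ge0 => ? _.
  by move=> /=; lra.
- by rewrite !gen_Absorbed subr0.
- by rewrite gen_hext_Inner -addrA lerD2l gen_edge_potential_Inner.
Qed.
End Potential.

(** * Finite expected arrivals and the passage to the limit *)

Section Limit.
Context (R : realType) (N : nat) (G : barrier_graph R N).
Context (d : measure_display) (T : measurableType d) (P : probability T R).
Context (s0 : state G) (X : nat -> T -> state G) (hX : is_walk P s0 X).

Local Notation occ := (occ P X).

Definition mean m (g : state G -> R) : R := \sum_s occ m s * g s.

Lemma mean0 g : mean 0 g = g s0.
Proof.
by rewrite /mean; under eq_bigr do rewrite (occ0 hX); exact: sum_pred1.
Qed.

Lemma meanS m g : mean m.+1 g = mean m (gen g).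
Proof.
rewrite /mean /gen; under eq_bigr do rewrite (occS hX) mulr_suml.
rewrite exchange_big/=; apply: eq_bigr => s _; rewrite mulr_sumr.
by apply: eq_bigr => t _; rewrite mulrA.
Qed.

Lemma mean_telescope M g :
  mean M g = g s0 + \sum_(0 <= m < M) mean m (fun s => gen g s - g s).
Proof.
elim: M => [|M IH]; first by rewrite big_nil addr0 mean0.
rewrite big_nat_recr//= addrA -IH meanS -big_split/=.
by apply: eq_bigr => s _; rewrite -mulrDr addrC subrK.
Qed.

Lemma occ_le1 m s : occ m s <= 1.
Proof.
by rewrite -lee_fin -(occE hX); exact/probability_le1/(measurable_walk hX).
Qed.

(** The mean of V loses at least [occ m s * w s] at each time m, yet stays bounded below because V
    takes finitely many values. *)
Lemma cvg_series_occ s : absorption_accessible G ->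
  (forall i, s <> Absorbed G i) -> cvgn (series (occ^~ s)).
Proof.
move=> /exists_potential[V [w [wA w0 wpos gV]]] /wpos ws.
apply: nondecreasing_is_cvgn.
  by apply: nondecreasing_series => m _ _; exact: (occ_ge0 hX).
exists ((V s0 + \sum_t `|V t|) / w s) => _ [M _ <-].
rewrite ler_pdivlMr// /series/= mulr_suml.
have : - (\sum_t `|V t|) <= mean M V.
  rewrite lerNl -sumrN; apply: ler_sum => t _.
  rewrite (le_trans (ler_norm _))// normrN normrM ger0_norm ?(occ_ge0 hX)//.
  by rewrite ler_piMl// occ_le1.
rewrite mean_telescope => le1.
suff : \sum_(0 <= m < M) occ m s * w s
    <= - \sum_(0 <= m < M) mean m (fun t => gen V t - V t).
  by lra.
rewrite -sumrN; apply: ler_sum => m _; rewrite /mean -sumrN (bigD1 s)//=.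
rewrite -[leLHS]addr0 lerD//.
  by rewrite -mulrN ler_wpM2l ?(occ_ge0 hX)// opprB lerBrDr addrC -lerBrDr gV.
apply: sumr_ge0 => t _; rewrite -mulrN mulr_ge0 ?(occ_ge0 hX)// opprB subr_ge0.
by rewrite (le_trans (gV t))// gerBl.
Qed.

(** [hext] vanishes on absorbed states; elsewhere the occupation probabilities are terms of a
    convergent series. *)
Lemma mean_hext_cvg0 c : absorption_accessible G ->
  mean M (hext c) @[M --> \oo] --> 0.
Proof.
move=> habs; rewrite [X in _ --> X](_ : 0 = \sum_(s : state G) 0); last first.
  by rewrite big1.
apply: cvg_big; first exact: add_continuous.
move=> s _; case: s => [k|i|e k].
- rewrite -[X in _ --> X](mul0r (c k)); apply: cvgMl.
  by apply: cvg_series_cvg_0; exact: cvg_series_occ.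
- by rewrite /=; under eq_fun do rewrite mulr0; exact: cvg_cst.
- rewrite -[X in _ --> X](mul0r (hext c (Inner k))); apply: cvgMl.
  by apply: cvg_series_cvg_0; exact: cvg_series_occ.
Qed.

Lemma sum_barriers (F : state G -> R) :
    (forall i, F (Absorbed G i) = 0) ->
    (forall e (k : 'I_(inner_size G e)), F (Inner k) = 0) ->
  \sum_s F s = \sum_k F (Barrier G k).
Proof.
move=> FA FI.
have FE s : F s = \sum_k (s == Barrier G k)%:R * F (Barrier G k).
  case: s => [k|i|e k].
  - rewrite (bigD1 k)//= eqxx mul1r big1 ?addr0// => l lk.
    by case: eqP => [[kl]|_]; [rewrite kl eqxx in lk|rewrite mul0r].
  - by rewrite FA big1// => l _; rewrite mul0r.
  - by rewrite FI big1// => l _; rewrite mul0r.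
under eq_bigr do rewrite FE.
rewrite exchange_big/=; apply: eq_bigr => k _.
exact: (sum_pred1 (fun=> F (Barrier G k))).
Qed.

(** The extension has zero drift at inner and absorbed states, so only visits to barriers survive in
    the telescoped sum. *)
Lemma mean_hext M c :
  mean M (hext c) = hext c s0
    + \sum_k (\sum_i c i * u G i k) * series (occ^~ (Barrier G k)) M.
Proof.
rewrite mean_telescope; congr (_ + _).
under [RHS]eq_bigr do rewrite /series/= mulr_sumr.
rewrite [RHS]exchange_big/=; apply: eq_bigr => m _; rewrite /mean sum_barriers.
- by apply: eq_bigr => k _; rewrite sum_u mulrC.
- by move=> i; rewrite gen_Absorbed subrr mulr0.
- by move=> e k; rewrite gen_hext_Inner subrr mulr0.
Qed.

Lemma expected_arrivalsE s : absorption_accessible G ->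
  (forall i, s <> Absorbed G i) ->
  expected_arrivals P X s = (limn (series (occ^~ s)))%:E.
Proof.
move=> habs sA; rewrite -EFin_lim; last exact: cvg_series_occ.
rewrite /expected_arrivals; congr (limn _); apply/funext => M /=.
by rewrite -sumEFin; apply: eq_bigr => m _; rewrite (occE hX).
Qed.

Lemma expected_arrivals_eq i : absorption_accessible G ->
  \sum_k u G i k * fine (expected_arrivals P X (Barrier G k))
  = - hext (fun j => (j == i)%:R) s0.
Proof.
move=> habs; pose c j : R := (j == i)%:R.
have sum_c k : \sum_j c j * u G j k = u G i k by rewrite sum_pred1.
apply/eqP; rewrite -addr_eq0 addrC; apply/eqP.
have := mean_hext_cvg0 c habs; under eq_fun do rewrite mean_hext.
(* The termwise limit of the telescoped mean must agree with the limit 0. *)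
move=> cvg0; apply: (norm_cvg_unique _ cvg0).
apply: cvgD; first exact: cvg_cst.
apply: cvg_big; first exact: add_continuous.
move=> k _; under eq_fun do rewrite sum_c; apply: cvgMr.
by rewrite expected_arrivalsE//=; exact: cvg_series_occ.
Qed.
End Limit.

Theorem theorem1 (R : realType) (N : nat) (G : barrier_graph R N)
    (habs : absorption_accessible G)
    (d : measure_display) (T : measurableType d) (P : probability T R)
    (X : nat -> T -> state G) (hX : is_walk P (Barrier G ord0) X) :
  let y := fun k : 'I_N.+1 => expected_arrivals P X (Barrier G k) in
  [/\ forall k, y k \is a fin_num,
      solves G (fun k => fine (y k)) &
      forall z : 'I_N.+1 -> R, solves G z -> forall k, z k = fine (y k)].
Proof.
move=> y; have y_solves : solves G (fun k => fine (y k)).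
  by move=> i; rewrite (expected_arrivals_eq hX)//= eq_sym.
split=> [k|//|z z_solves k]; first by rewrite /y (expected_arrivalsE hX).
have uU := u_unitmx habs.
pose col (x : 'I_N.+1 -> R) : 'cV[R]_N.+1 := \col_i x i.
have mul_col x : solves G x ->
    (\matrix_(i, j) u G i j) *m col x = \col_i - (i == ord0)%:R.
  move=> xs; apply/colP => i; rewrite !mxE -xs.
  by apply: eq_bigr => j _; rewrite !mxE.
have : col z = col (fun k => fine (y k)).
  by rewrite -[LHS](mulKmx uU) -[RHS](mulKmx uU) !mul_col.
by move=> /colP/(_ k); rewrite !mxE.
Qed.
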